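(* Let $\alpha\in\mathbb{R}$. Then, for any $f\in\bigcup_{r\in[1,\infty)}\bigcap_{p\in[r,\infty)}JNQ^{\alpha}_{p,2}(\mathbb{R}^n)$, it holds true that $$\lim_{p\to\infty}\|f\|_{JNQ^{\alpha}_{p,2}(\mathbb{R}^n)}=\|f\|_{Q_\alpha(\mathbb{R}^n)},$$ where the right-hand side is possibly infinite.
   Context: Here $n\in\mathbb{N}$, $n\ge1$. A measurable function $f$ on $\mathbb{R}^n$ is a Lebesgue measurable function with $|f|<\infty$ almost everywhere. A cube has finite positive edge length and all its edges parallel to the coordinate axes, and need not be open or closed. For $\ell\in(0,\infty)$, $\Pi_\ell$ is the class of all collections $\{Q_j\}_j$ of cubes of $\mathbb{R}^n$ with pairwise disjoint interiors and equal edge length $\ell$. For $p\in[1,\infty)$ and $\alpha\in\mathbb{R}$, $JNQ^{\alpha}_{p,2}(\mathbb{R}^n)$ is the set of all measurable $f$ on $\mathbb{R}^n$ with $$\|f\|_{JNQ^\alpha_{p,2}(\mathbb{R}^n)}:=\sup_{\ell\in(0,\infty),\,\{Q_j\}_j\in\Pi_\ell}\Big\{\sum_j|Q_j|\Big[|Q_j|^{\frac{2\alpha}{n}-1}\int_{Q_j}\int_{Q_j}\frac{|f(x)-f(y)|^2}{|x-y|^{n+2\alpha}}\,dy\,dx\Big]^{p/2}\Big\}^{1/p}<\infty.$$ For a measurable function $f$, $$\|f\|_{Q_\alpha(\mathbb{R}^n)}:=\sup_{Q}\Big[|Q|^{\frac{2\alpha}{n}-1}\int_Q\int_Q\frac{|f(x)-f(y)|^2}{|x-y|^{n+2\alpha}}\,dy\,dx\Big]^{1/2}\in[0,\infty],$$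 the supremum being over all cubes $Q$ of $\mathbb{R}^n$. *)

(* Defs.v *)
From HB Require Import structures.
From mathcomp Require Import all_boot all_order all_algebra.
From mathcomp Require Import all_classical all_reals all_analysis.
From mathcomp Require Import measurable_realfun.

Set Implicit Arguments.
Unset Strict Implicit.
Unset Printing Implicit Defensive.

Import Order.TTheory GRing.Theory Num.Theory.
Import numFieldNormedType.Exports.

Local Open Scope classical_set_scope.
Local Open Scope ring_scope.
Local Open Scope ereal_scope.

(* The space R^d with d >= 1 is 'rV[R]_n.+1, i.e. d = n.+1. Its Lebesgue
   measure is built in the classical way: the outer measure given by countable
   coverings with half-open boxes, restricted to the Caratheodory measurable
   sets, which are exactly the Lebesgue measurable sets. *)

Section lebesgue_measure_rV.
Context (R : realType) (n : nat).
Local Notation Rn := 'rV[R]_n.+1.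

Definition box (c : Rn * Rn) : set Rn :=
  [set x | forall i, x 0%R i \in `]c.1 0%R i, c.2 0%R i]%R].

Definition box_volume (c : Rn * Rn) : R :=
  (\prod_(i < n.+1) (c.2 0 i - c.1 0 i))%R.

Definition box_cover (A : set Rn) : set (nat -> Rn * Rn) :=
  [set c : nat -> Rn * Rn | (forall k i, (c k).1 0%R i <= (c k).2 0%R i)%R /\
           A `<=` \bigcup_k box (c k)].

Definition cover_volume (c : nat -> Rn * Rn) : \bar R :=
  \sum_(k <oo) (box_volume (c k))%:E.

Definition lebesgue_outer (A : set Rn) : \bar R :=
  ereal_inf [set cover_volume c | c in box_cover A].

Lemma box_volume_ge0 A (c : nat -> Rn * Rn) k : box_cover A c -> 0 <= (box_volume (c k))%:E.
Proof.
by move=> [c_le _]; rewrite lee_fin prodr_ge0// => i _; rewrite subr_ge0.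
Qed.

Lemma lebesgue_outer_ge0 A : 0 <= lebesgue_outer A.
Proof.
apply: le_ereal_inf_tmp => _ [c cA <-]; apply: nneseries_ge0 => k _ _.
exact: box_volume_ge0 cA.
Qed.

Lemma lebesgue_outer0 : lebesgue_outer set0 = 0.
Proof.
apply/eqP; rewrite eq_le lebesgue_outer_ge0 andbT.
apply: ereal_inf_lbound; exists (fun=> (0%R, 0%R)); first by split.
rewrite /cover_volume eseries0// => k _ _; congr (_%:E).
by rewrite /box_volume big_ord_recl subrr mul0r.
Qed.

Lemma le_lebesgue_outer : {homo lebesgue_outer : A B / A `<=` B >-> A <= B}.
Proof.
move=> A B AB; apply: ereal_inf_le_tmp => _ [c [c_le cB] <-]; exists c => //.
by split => //; exact: subset_trans cB.
Qed.

Lemma lebesgue_outer_sigma_subadditive : sigma_subadditive lebesgue_outer.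
Proof.
move=> A; have [[i ioo]|] := pselect (exists i, lebesgue_outer (A i) = +oo).
  rewrite (eseries_pinfty _ _ ioo) ?leey// => k _.
  by rewrite -ltNye (lt_le_trans _ (lebesgue_outer_ge0 _)).
rewrite -forallNE => Aoo; apply/lee_addgt0Pr => e e0.
rewrite (le_trans _ (epsilon_trick _ _ (ltW e0)))//; last first.
  by move=> k; exact: lebesgue_outer_ge0.
pose P m c := box_cover (A m) c /\ cover_volume c <=
  lebesgue_outer (A m) + (e / (2 ^ m.+1)%:R)%:E.
have [G PG] : {G & forall m, P m (G m)}.
  apply: (@choice _ _ P) => m.
  have Afin : lebesgue_outer (A m) \is a fin_num.
    by rewrite ge0_fin_numE ?lebesgue_outer_ge0// ltey; apply/eqP/Aoo.
  have em0 : (0 < e / (2 ^ m.+1)%:R)%R by rewrite divr_gt0// ltr0n expn_gt0.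
  have [_ [c cA <-] /ltW cle] := lb_ereal_inf_adherent em0 Afin.
  by exists c.
pose g (p : nat * nat) := (box_volume (G p.1 p.2))%:E.
have g0 p : 0 <= g p by exact: box_volume_ge0 (PG p.1).1.
apply: (@le_trans _ _ (\esum_(p in setT) g p)).
  have /card_esym/ppcard_eqP[h] := card_nat2.
  apply: ereal_inf_lbound => /=; exists (fun k => G (h k).1 (h k).2).
    split=> [k i|x [m _ Amx]]; first exact: (PG _).1.1.
    have [k _ xk] := (PG m).1.2 _ Amx.
    by exists (h^-1%FUN (m, k)) => //=; rewrite invK ?inE.
  rewrite /cover_volume -[LHS]/(\sum_(k <oo | xpredT k) g (h k)).
  rewrite -(esum_pred_image g h xpredT) ?[fun=> _]set_true//.
  by rewrite image_eq.
have -> : \esum_(p in setT) g p = \esum_(m in setT) \esum_(k in setT) g (m, k).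
  rewrite (esum_esum (fun m k _ _ => g0 (m, k))); congr esum.
  by apply/seteqP; split.
rewrite nneseries_esumT; last first.
  by move=> m; rewrite adde_ge0 ?lebesgue_outer_ge0// lee_fin divr_ge0 ?ltW.
apply: le_esum => m _; rewrite -nneseries_esumT//; exact: (PG m).2.
Qed.

HB.instance Definition _ := isOuterMeasure.Build R Rn lebesgue_outer
  lebesgue_outer0 lebesgue_outer_ge0 le_lebesgue_outer
  lebesgue_outer_sigma_subadditive.

End lebesgue_measure_rV.

Arguments lebesgue_outer {R n}.

(* The carrier is 'rV[R]_n.+1; the alias carries the Lebesgue sigma-algebra. *)
Notation lebesgueType R n := (caratheodory_type (@lebesgue_outer R n)).

Definition lebesgue_rV (R : realType) (n : nat) :
  set (lebesgueType R n) -> \bar R := lebesgue_outer.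

HB.instance Definition _ (R : realType) (n : nat) :=
  isMeasure.Build _ _ _ (@lebesgue_rV R n)
    (caratheodory_measure0 (@lebesgue_outer R n))
    (caratheodory_measure_ge0 (mu := @lebesgue_outer R n))
    (caratheodory_measure_sigma_additive (mu := @lebesgue_outer R n)).

Section JNQ.
Context (R : realType) (n : nat).
Local Notation Rn := 'rV[R]_n.+1.
Local Notation mu := (@lebesgue_rV R n).

Definition measurable_ae_finite (f : Rn -> \bar R) :=
  measurable_fun [set: lebesgueType R n] (f : lebesgueType R n -> \bar R) /\
  {ae mu, forall x, f x \is a fin_num}.

(* The norm of 'rV[R]_n.+1 in the library is the sup norm. *)
Definition euclidean_norm (x : Rn) : R := Num.sqrt (\sum_i x 0 i ^+ 2)%R.

(* Any product of intervals of length l: the left endpoint of edge i belongs to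
   the cube iff lo i = true, the right one iff hi i = false. *)
Definition is_cube (l : R) (Q : set Rn) :=
  exists (a : Rn) (lo hi : 'I_n.+1 -> bool),
    Q = [set x : Rn | forall i, x 0%R i \in
          Interval (BSide (lo i) (a 0%R i)) (BSide (hi i) (a 0%R i + l)%R)].

Definition cubes : set (set Rn) := \bigcup_(l in `]0%R, +oo[) is_cube l.

Definition Pi_ (l : R) : set (set (set Rn)) :=
  [set C | C `<=` is_cube l /\ trivIset C (fun Q => Q°)].

Definition Q_osc (alpha : R) (f : Rn -> \bar R) (Q : set Rn) : \bar R :=
  mu Q `^ (2 * alpha / n.+1%:R - 1) *
  \int[mu]_(x in Q) \int[mu]_(y in Q)
    (`|f x - f y| ^+ 2 *
     ((euclidean_norm ((x : Rn) - (y : Rn))%R `^ (n.+1%:R + 2 * alpha))^-1)%:E).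

Definition JNQ_norm (alpha p : R) (f : Rn -> \bar R) : \bar R :=
  ereal_sup [set (\esum_(Q in C) (mu Q * Q_osc alpha f Q `^ (p / 2))) `^ p^-1
            | C in \bigcup_(l in `]0%R, +oo[) Pi_ l].

Definition JNQ (alpha p : R) : set (Rn -> \bar R) :=
  [set f | measurable_ae_finite f /\ JNQ_norm alpha p f < +oo].

Definition Q_norm (alpha : R) (f : Rn -> \bar R) : \bar R :=
  ereal_sup [set Q_osc alpha f Q `^ 2^-1 | Q in cubes].

End JNQ.

(* Main.v *)
Require Import Defs.
From HB Require Import structures.
From mathcomp Require Import all_boot all_order all_algebra.
From mathcomp Require Import all_classical all_reals all_analysis.
From mathcomp Require Import measurable_realfun.
Import Order.TTheory GRing.Theory Num.Theory.
Import numFieldNormedType.Exports.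
Local Open Scope classical_set_scope.
Local Open Scope ring_scope.

(** This is the classical fact that weighted l^p norms tend to the sup norm as
p tends to infinity. Write w for the measure of a cube and b for the square
root of its oscillation: the JNQ norm is then the supremum, over the admissible
collections C, of the weighted l^p norm (sum over C of w b^p)^(1/p), and the Q
norm is the supremum of b over all cubes.

If m bounds all the b's, then b^p <= m^(p-r) b^r, so that a finite norm N_r at
one exponent r controls the later ones: N_p <= m^(1-r/p) N_r^(r/p), which
tends to m ([sup_sum_norm_le], [near_sup_sum_norm_lt]). Conversely a cube is by
itself an admissible collection, so N_p >= w^(1/p) b, whose limit is at least b
as soon as w > 0 ([near_sup_sum_norm_gt]). The latter also covers b = +oo, hence the
case of an infinite Q norm.

That cubes have positive measure never has to be established: a double integral
over a null set vanishes, so a cube with w = 0 has b = 0 ([Q_osc_null]) and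
bounds nothing from below. *)

Lemma powR_cvg_exponent (R : realType) (T : Type) (F : set_system T)
  (FF : Filter F) (a : R) (e : T -> R) (l : R) :
  0 < a -> e t @[t --> F] --> l -> (a `^ e t) @[t --> F] --> a `^ l.
Proof.
move=> a0 el; rewrite /powR gt_eqF//.
apply: continuous_cvg; first exact: continuous_expR.
by apply: cvgM => //; exact: cvg_cst.
Qed.

Lemma cvg_invr_pinfty (R : realType) : p^-1 @[p --> +oo] --> (0%R : R).
Proof.
apply/(gtr0_cvgV0 (f := @id R)); last exact: cvg_id.
exact: nbhs_pinfty_gt.
Qed.

(** Comparing finite subsums avoids having to distribute the factor, which may
be infinite, over a sum on an arbitrary index set. *)
Lemma esum_le_scale (R : realType) (T : choiceType) (I : set T)
  (u v : T -> \bar R) (k : \bar R) :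
  (0 <= k)%E -> (forall i, 0 <= v i)%E -> (forall i, I i -> u i <= k * v i)%E ->
  (\esum_(i in I) u i <= k * \esum_(i in I) v i)%E.
Proof.
move=> k0 v0 uv; apply: ge_ereal_sup => _ [A [finA AI] <-].
apply: (@le_trans _ _ (k * \sum_(i \in A) v i)%E).
  rewrite ge0_mule_fsumr//; apply: lee_fsum => // i Ai.
  exact/uv/AI.
by apply: lee_wpmul2l => //; apply: ereal_sup_ubound; exists A.
Qed.

Section sup_sum_norm.
Context (R : realType) (T : choiceType).
Implicit Types (w b : T -> \bar R) (F : set (set T)).
Local Open Scope ereal_scope.

Definition sup_sum_norm w b F (p : R) : \bar R :=
  ereal_sup [set (\esum_(i in C) (w i * b i `^ p)) `^ p^-1 | C in F].

(** Interpolation between the exponents r and infinity: b^p <= m^(p-r) b^r,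
summed against the weights, and then the p-th root. The weights enter only
through the norm of exponent r, so their total mass may be infinite. *)
Lemma sup_sum_norm_le w b F (r p m K : R) :
  (forall i, 0 <= w i) -> (forall i, 0 <= b i) ->
  (0 < r)%R -> (r <= p)%R -> (0 <= m)%R -> (0 <= K)%R ->
  (forall C i, F C -> C i -> b i <= m%:E) ->
  sup_sum_norm w b F r <= K%:E ->
  sup_sum_norm w b F p <= (m `^ (1 - r / p) * K `^ (r / p))%:E.
Proof.
move=> w0 b0 r0 rp m0 K0 bm NK.
have p0 : (0 < p)%R by exact: lt_le_trans rp.
apply: ge_ereal_sup => _ [C FC <-].
have s0 : 0 <= \esum_(i in C) (w i * b i `^ r).
  by apply: esum_ge0 => i _; rewrite mule_ge0// poweR_ge0.
have sr : \esum_(i in C) (w i * b i `^ r) <= (K `^ r)%:E.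
  have : (\esum_(i in C) (w i * b i `^ r)) `^ r^-1 <= K%:E.
    by apply: le_trans NK; apply: ereal_sup_ubound; exists C.
  move=> /(gt0_ler_poweR (ltW r0)).
  rewrite !in_itv/= !leey !andbT poweR_ge0 lee_fin K0 => /(_ isT isT).
  by rewrite -poweRrM mulVf ?gt_eqF// poweRe1.
have sp : \esum_(i in C) (w i * b i `^ p) <= (m `^ (p - r) * K `^ r)%:E.
  rewrite EFinM.
  apply: (@le_trans _ _ ((m `^ (p - r))%:E * \esum_(i in C) (w i * b i `^ r))).
    apply: esum_le_scale => [|i|i Ci].
    - by rewrite lee_fin powR_ge0.
    - by rewrite mule_ge0// poweR_ge0.
    - rewrite muleCA lee_wpmul2l// -{1}(subrK r p).
      rewrite poweRD; last by apply: add_neq0_poweRD_def; rewrite subrK gt_eqF.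
      rewrite lee_wpmul2r ?poweR_ge0// -poweR_EFin.
      apply: gt0_ler_poweR; rewrite ?in_itv/= ?leey ?andbT ?subr_ge0//.
      exact: bm Ci.
  by rewrite lee_wpmul2l// lee_fin powR_ge0.
have -> : ((m `^ (1 - r / p) * K `^ (r / p)) =
    (m `^ (p - r) * K `^ r) `^ p^-1)%R.
  by rewrite powRM ?powR_ge0// -!powRrM mulrBl divff ?gt_eqF.
rewrite -poweR_EFin.
apply: gt0_ler_poweR; rewrite ?in_itv/= ?leey ?andbT ?invr_ge0 ?(ltW p0)//.
  by apply: esum_ge0 => i _; rewrite mule_ge0// poweR_ge0.
by rewrite lee_fin mulr_ge0// powR_ge0.
Qed.

Lemma sup_sum_norm_ge w b F (p : R) i :
  (forall i, 0 <= w i) -> (forall i, 0 <= b i) -> (0 < p)%R ->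
  F [set i] -> w i `^ p^-1 * b i <= sup_sum_norm w b F p.
Proof.
move=> w0 b0 p0 Fi; apply: ereal_sup_ubound; exists [set i] => //.
rewrite esum_set1 ?mule_ge0 ?poweR_ge0// poweRM ?poweR_ge0//.
by rewrite -poweRrM divff ?gt_eqF// poweRe1.
Qed.

(** The interpolation bound is applied to a number m' strictly between the
supremum and y, and to a positive K; this keeps the bases of both real powers
positive, where the power is continuous in its exponent, even if the supremum
or the norm of exponent r is 0. *)
Lemma near_sup_sum_norm_lt w b F (r y : R) :
  (forall i, 0 <= w i) -> (forall i, 0 <= b i) -> (0 < r)%R ->
  sup_sum_norm w b F r < +oo ->
  0 <= ereal_sup (b @` \bigcup_(C in F) C) ->
  ereal_sup (b @` \bigcup_(C in F) C) < y%:E ->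
  \forall p \near +oo%R, sup_sum_norm w b F p < y%:E.
Proof.
move=> w0 b0 r0 Nr; set M := ereal_sup _ => M0 My.
have Mfin : M \is a fin_num by rewrite ge0_fin_numE// (lt_trans My)// ltry.
have mM : ((fine M)%:E = M) by rewrite fineK.
have m0 : (0 <= fine M)%R by exact: fine_ge0.
have my : (fine M < y)%R by rewrite -lte_fin mM.
pose m' := ((fine M + y) / 2)%R.
have [mm' m'y] : ((fine M < m') /\ (m' < y))%R by rewrite midf_lt// midf_lt.
have m'0 : (0 < m')%R by exact: le_lt_trans mm'.
have [K K0 NK] : exists2 K : R, (0 < K)%R & sup_sum_norm w b F r <= K%:E.
  case: (sup_sum_norm w b F r) Nr => [k _|//|_]; last first.
    by exists 1%R; rewrite ?ltr01 ?leNye.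
  by exists (Num.max 1%R k); rewrite ?lt_max ?ltr01// lee_fin le_max lexx orbT.
have h : (m' `^ (1 - r / p) * K `^ (r / p))%R @[p --> +oo%R] --> m'.
  have rp : (r / p)%R @[p --> +oo%R] --> (0%R : R).
    rewrite -[X in _ --> X](mulr0 r).
    by apply: cvgM; [exact: cvg_cst|exact: cvg_invr_pinfty].
  rewrite -[X in _ --> X]mulr1 -{2}(powRr0 K) -{2}(powRr1 (ltW m'0)).
  apply: cvgM; apply: powR_cvg_exponent => //.
  by rewrite -[X in _ --> X]subr0; apply: cvgB => //; exact: cvg_cst.
have hy := cvgr_lt _ h _ m'y.
near=> p; apply: (@le_lt_trans _ _ (m' `^ (1 - r / p) * K `^ (r / p))%:E);
  last first.
  by rewrite lte_fin; near: p; exact: hy.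
apply: sup_sum_norm_le => //.
- exact: ltW.
- exact: ltW.
- move=> C i FC Ci; apply: (@le_trans _ _ M).
    by apply: ereal_sup_ubound; exists i => //; exists C.
  by rewrite -mM lee_fin ltW.
Unshelve. all: by end_near. Qed.

(** Both w i and b i may be infinite. Replacing them by positive real c <= w i
and real d with y < d <= b i, the lower bound c^(1/p) d tends to d. *)
Lemma near_sup_sum_norm_gt w b F i (y : R) :
  (forall i, 0 <= w i) -> (forall i, 0 <= b i) -> F [set i] -> 0 < w i ->
  y%:E < b i ->
  \forall p \near +oo%R, y%:E < sup_sum_norm w b F p.
Proof.
move=> w0 b0 Fi wi yb.
have [c c0 cw] : exists2 c : R, (0 < c)%R & c%:E <= w i.
  case: (w i) wi => [k||]//; last by exists 1%R; rewrite ?ltr01 ?leey.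
  by rewrite lte_fin => k0; exists k.
have [d dy db] : exists2 d : R, (y < d)%R & d%:E <= b i.
  case: (b i) yb => [k||]//.
    by rewrite lte_fin => yk; exists k.
  by exists (y + 1)%R; rewrite ?ltrDl ?ltr01 ?leey.
have h : (c `^ p^-1 * d)%R @[p --> +oo%R] --> d.
  rewrite -[X in _ --> X]mul1r -(powRr0 c).
  apply: cvgM; last exact: cvg_cst.
  by apply: powR_cvg_exponent => //; exact: cvg_invr_pinfty.
have hy := cvgr_gt _ h _ dy.
near=> p.
have p0 : (0 < p)%R by near: p; exact: nbhs_pinfty_gt.
apply: (@lt_le_trans _ _ (c `^ p^-1 * d)%:E).
  by rewrite lte_fin; near: p; exact: hy.
apply: le_trans (@sup_sum_norm_ge w b F p i w0 b0 p0 Fi).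
rewrite EFinM; apply: (@le_trans _ _ ((c `^ p^-1)%:E * b i)).
  by rewrite lee_wpmul2l// lee_fin powR_ge0.
rewrite lee_wpmul2r// -poweR_EFin.
apply: gt0_ler_poweR; rewrite ?in_itv/= ?leey ?andbT ?invr_ge0 ?(ltW p0)//.
by rewrite lee_fin ltW.
Unshelve. all: by end_near. Qed.

(** Indices of weight 0 contribute nothing to the sums, so the supremum on the
right would see values that the norms cannot; hence the requirement that [b]
vanish there. *)
Lemma sup_sum_norm_cvg w b F (r : R) :
  (forall i, 0 <= w i) -> (forall i, 0 <= b i) ->
  (forall i, w i = 0 -> b i = 0) ->
  (forall C i, F C -> C i -> F [set i]) ->
  \bigcup_(C in F) C !=set0 ->
  (0 < r)%R -> sup_sum_norm w b F r < +oo ->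
  sup_sum_norm w b F p @[p --> +oo%R] -->
    ereal_sup (b @` \bigcup_(C in F) C).
Proof.
move=> w0 b0 wb F1 [j [D FD Dj]] r0 Nr.
have supN0 p : 0 <= sup_sum_norm w b F p.
  apply: (@le_trans _ _ ((\esum_(i in D) (w i * b i `^ p)) `^ p^-1)).
    exact: poweR_ge0.
  by apply: ereal_sup_ubound; exists D.
have M0 : 0 <= ereal_sup (b @` \bigcup_(C in F) C).
  apply: le_trans (b0 j) _.
  by apply: ereal_sup_ubound; exists j => //; exists D.
have lower (y : R) : y%:E < ereal_sup (b @` \bigcup_(C in F) C) ->
    \forall p \near +oo%R, y%:E < sup_sum_norm w b F p.
  move=> /ereal_sup_gt[_ [i [C FC Ci] <-] yb].
  have [wi0|wi0] := eqVneq (w i) 0.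
    near=> p; apply: lt_le_trans (supN0 p).
    by rewrite -(wb _ wi0).
  apply: near_sup_sum_norm_gt yb => //; first exact: F1 Ci.
  by rewrite lt0e wi0 w0.
have := @near_sup_sum_norm_lt w b F r _ w0 b0 r0 Nr M0.
case: (ereal_sup _) M0 lower => [m||]//.
- move=> m0 lower upper; apply/fine_cvgP; split.
    near=> p; rewrite ge0_fin_numE//.
    apply: (@lt_trans _ _ (m + 1)%:E); last exact: ltry.
    by near: p; apply: upper; rewrite lte_fin ltrDl.
  apply/cvgrPdist_lt => e e0; near=> p => /=.
  have lo : (m - e)%:E < sup_sum_norm w b F p.
    by near: p; apply: lower; rewrite lte_fin ltrBlDr ltrDl.
  have up : sup_sum_norm w b F p < (m + e)%:E.
    by near: p; apply: upper; rewrite lte_fin ltrDl.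
  case: (sup_sum_norm w b F p) lo up => [x||]//=; rewrite !lte_fin => lo up.
  by rewrite distrC ltr_distl lo up.
- by move=> _ lower _; apply/cvgeyPgt => A; exact/lower/ltry.
Unshelve. all: by end_near. Qed.

End sup_sum_norm.

Arguments sup_sum_norm {R T}.

Section Q_osc.
Context (R : realType) (n : nat).
Local Open Scope ereal_scope.
Local Notation mu := (@lebesgue_rV R n).

(** Caratheodory measurability makes every subset of a null set measurable, so
that any integrand whatsoever is measurable on [Q]. *)
Lemma integral_lebesgue_null (Q : set 'rV[R]_n.+1) (g : 'rV[R]_n.+1 -> \bar R) :
  mu Q = 0 -> \int[mu]_(x in Q) g x = 0.
Proof.
move=> Q0.
have null (A : set 'rV[R]_n.+1) : A `<=` Q ->
    measurable (A : set (lebesgueType R n)).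
  move=> AQ; apply: le_caratheodory_measurable => X.
  rewrite -[leRHS]add0e -[in leRHS]Q0; apply: leeD; apply: le_outer_measure.
    by apply: subset_trans AQ; exact: subIsetr.
  exact: subIsetl.
apply: null_set_integral => //; first exact: null.
by move=> _ B _; apply: null => x [].
Qed.

Lemma Q_osc_ge0 alpha f (Q : set 'rV[R]_n.+1) : 0 <= Q_osc alpha f Q.
Proof.
apply: mule_ge0; first exact: poweR_ge0.
apply: integral_ge0 => x _; apply: integral_ge0 => y _.
by rewrite mule_ge0 ?expe_ge0// lee_fin invr_ge0 powR_ge0.
Qed.

Lemma Q_osc_null alpha f (Q : set 'rV[R]_n.+1) :
  mu Q = 0 -> Q_osc alpha f Q = 0.
Proof. by move=> Q0; rewrite /Q_osc integral_lebesgue_null// mule0. Qed.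

Lemma JNQ_normE alpha p (f : 'rV[R]_n.+1 -> \bar R) :
  JNQ_norm alpha p f = sup_sum_norm mu
    (fun Q => Q_osc alpha f Q `^ 2^-1) (\bigcup_(l in `]0%R, +oo[) Pi_ l) p.
Proof.
congr ereal_sup; apply: eq_imagel => C _; congr (_ `^ _).
by apply: eq_esum => Q _; rewrite -poweRrM (mulrC p).
Qed.

Lemma bigcup_Pi_cubes :
  \bigcup_(C in \bigcup_(l in `]0%R, +oo[) @Pi_ R n l) C = @cubes R n.
Proof.
apply/seteqP; split => [Q [C [l l0 [Cl _]] CQ]|Q [l l0 Ql]].
  by exists l => //; exact: Cl.
exists [set Q] => //; exists l => //; split=> [_ ->//|].
by move=> A B -> ->.
Qed.
End Q_osc.

Theorem proposition2p10 (R : realType) (n : nat) (alpha : R)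
  (f : 'rV[R]_n.+1 -> \bar R)
  (hf : (\bigcup_(r in `[1%R, +oo[) \bigcap_(p in `[r, +oo[) JNQ alpha p) f) :
  JNQ_norm alpha p f @[p --> +oo] --> Q_norm alpha f.
Proof.
have [r r1 fr] := hf; rewrite /= in_itv/= andbT in r1.
have r0 : 0 < r by exact: lt_le_trans ltr01 r1.
have [_ Nr] : JNQ alpha r f by apply: fr; rewrite /= in_itv/= lexx.
have -> : (fun p => JNQ_norm alpha p f) = sup_sum_norm (@lebesgue_rV R n)
    (fun Q => Q_osc alpha f Q `^ 2^-1)%E (\bigcup_(l in `]0, +oo[) @Pi_ R n l).
  by apply/funext => p; exact: JNQ_normE.
rewrite /Q_norm -bigcup_Pi_cubes.
apply: (@sup_sum_norm_cvg _ _ _ _ _ r) => //.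
- by move=> Q; exact: poweR_ge0.
- by move=> Q /Q_osc_null->; rewrite poweR0r// invr_eq0 pnatr_eq0.
- move=> C Q [l l0 [Cl _]] CQ; exists l => //; split=> [_ ->|A B -> ->//].
  exact: Cl.
- rewrite bigcup_Pi_cubes; eexists; exists 1; first by rewrite /= in_itv/= ltr01.
  by exists 0, xpredT, xpredT.
- by rewrite -JNQ_normE.
Qed.
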